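(* Let $R$ be a commutative ring and $q\in R$ such that $R$ is $q$-torsion free and $qR$ is a prime ideal, and let $n,r$ be integers with $r>n/2$. For every $f\in\mathrm{Aut}(\mathbb{A}^1_{R/q^n})$, every $g\in K_{n,r}(R,q)$ and every $c\in R$, $$\mathrm{Ad}_f(c\cdot g)=c\cdot\mathrm{Ad}_f(g).$$
   Context: For a commutative ring $B$, $\mathrm{Aut}(\mathbb{A}^1_B)$ denotes the group of polynomials $f\in B[T]$ invertible under composition, with group law composition. $K_{n,r}(R,q)=\{g\in\mathrm{Aut}(\mathbb{A}^1_{R/q^n}): g(T)\equiv T\bmod q^r\}$, the kernel of reduction to $\mathrm{Aut}(\mathbb{A}^1_{R/q^r})$. The adjoint action is $\mathrm{Ad}_f(g)=f\circ g\circ f^{-1}$. The $R$-multiplication on $K_{n,r}(R,q)$ is defined by $c\cdot(T+q^rh(T)):=T+q^r c\,h(T)$ for $g(T)=T+q^rh(T)$ and $c\in R$. *)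

(* Defs.v *)
From HB Require Import structures.
From mathcomp Require Import all_boot all_order all_algebra.
From mathcomp Require Import ring_quotient ring.
From mathcomp Require Import boolp.

Set Implicit Arguments.
Unset Strict Implicit.
Unset Printing Implicit Defensive.

Import GRing.Theory.
Local Open Scope ring_scope.
Local Open Scope quotient_scope.

Section AutA1.
Variable B : comNzRingType.
Implicit Types f g h : {poly B}.

Definition comp_invertible f :=
  exists g, f \Po g = 'X /\ g \Po f = 'X.

Record autA1 := AutA1 {
  aut_poly :> {poly B};
  aut_polyP : `[< comp_invertible aut_poly >]
}.

HB.instance Definition _ := [isSub for aut_poly].
HB.instance Definition _ := [Choice of autA1 by <:].

Fact autA1_one_subproof : `[< comp_invertible 'X >].
Proof. by apply/asboolP; exists 'X; rewrite comp_polyX. Qed.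
Definition autA1_one := AutA1 autA1_one_subproof.

Fact autA1_mul_subproof (f g : autA1) : `[< comp_invertible (f \Po g) >].
Proof.
have /asboolP[f' [ff' f'f]] := aut_polyP f.
have /asboolP[g' [gg' g'g]] := aut_polyP g.
apply/asboolP; exists (g' \Po f'); split.
  by rewrite -comp_polyA (comp_polyA (aut_poly g)) gg' comp_polyX.
by rewrite -comp_polyA (comp_polyA f') f'f comp_polyX.
Qed.
Definition autA1_mul (f g : autA1) := AutA1 (autA1_mul_subproof f g).

Fact autA1_inv_ex (f : autA1) :
  exists g, (aut_poly f \Po g == 'X) && (g \Po aut_poly f == 'X).
Proof.
by have /asboolP[g [fg gf]] := aut_polyP f; exists g; rewrite fg gf !eqxx.
Qed.

Fact autA1_inv_subproof (f : autA1) :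
  `[< comp_invertible (xchoose (autA1_inv_ex f)) >].
Proof.
have /andP[/eqP fg /eqP gf] := xchooseP (autA1_inv_ex f).
by apply/asboolP; exists (aut_poly f).
Qed.
Definition autA1_inv (f : autA1) := AutA1 (autA1_inv_subproof f).

Fact autA1_mulA : associative autA1_mul.
Proof. by move=> f g h; apply: val_inj; rewrite /= comp_polyA. Qed.
Fact autA1_mul1 : left_id autA1_one autA1_mul.
Proof. by move=> f; apply: val_inj; rewrite /= comp_polyX. Qed.
Fact autA1_mulr1 : right_id autA1_one autA1_mul.
Proof. by move=> f; apply: val_inj; rewrite /= comp_polyXr. Qed.
Fact autA1_mulV : left_inverse autA1_one autA1_inv autA1_mul.
Proof.
by move=> f; apply: val_inj => /=; case/andP: (xchooseP (autA1_inv_ex f)) => _ /eqP.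
Qed.
Fact autA1_mulVr : right_inverse autA1_one autA1_inv autA1_mul.
Proof.
by move=> f; apply: val_inj => /=; case/andP: (xchooseP (autA1_inv_ex f)) => /eqP.
Qed.

HB.instance Definition _ := isGroup.Build autA1
  autA1_mulA autA1_mul1 autA1_mulr1 autA1_mulV autA1_mulVr.

Lemma comp_poly_cong f p (a : B) h :
  exists k, f \Po (p + a *: h) = f \Po p + a *: k.
Proof.
elim/poly_ind: f => [|f c [k IH]].
  by exists 0; rewrite !comp_poly0 scaler0 addr0.
exists (k * (p + a *: h) + (f \Po p) * h).
rewrite !comp_polyD !comp_polyM !comp_polyX !comp_polyC IH.
by rewrite -!mul_polyC; ring.
Qed.

End AutA1.

Section Quotients.
Variable R : comNzRingType.
Implicit Types q c : R.

Definition torsion_free q := forall x : R, q * x = 0 -> x = 0.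

Definition principal_ideal q : {pred R} := [pred x | `[< exists y, x = q * y >]].

(* [idealr_closed] contains the properness [1 \notin qR]; its other two
   clauses hold for every q. *)
Definition generates_prime q :=
  idealr_closed (principal_ideal q) /\ prime_idealr_closed (principal_ideal q).

(* The ideal q^n R. Polynomials require a nonzero coefficient ring, so the
   arguments of the definition include what makes q^n R proper. *)
Definition power_ideal q n of generates_prime q & (0 < n)%N : {pred R} :=
  principal_ideal (q ^+ n).

Fact power_ideal_closed q n (qP : generates_prime q) (n0 : (0 < n)%N) :
  idealr_closed (power_ideal qP n0).
Proof.
split.
- by apply/asboolP; exists 0; rewrite mulr0.
- apply/negP => /asboolP[y y1]; have [[_ /negP q1 _] _] := qP; apply: q1.
  apply/asboolP; exists (q ^+ n.-1 * y).
  by rewrite mulrA -exprS prednK.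
- move=> a x y /asboolP[x' ->] /asboolP[y' ->].
  by apply/asboolP; exists (a * x' + y'); rewrite mulrDr mulrCA.
Qed.

HB.instance Definition _ q n (qP : generates_prime q) (n0 : (0 < n)%N) :=
  isIdealr.Build R (power_ideal qP n0) (power_ideal_closed qP n0).

Definition quot_power q n (qP : generates_prime q) (n0 : (0 < n)%N) : comNzRingType :=
  {ideal_quot (power_ideal qP n0)}.

End Quotients.

Section Kernels.
Variables (R : comNzRingType) (q : R) (qP : generates_prime q).
Variables (n : nat) (n0 : (0 < n)%N) (r : nat).
Local Notation Rn := (quot_power qP n0).

Definition proj_power (x : R) : Rn := \pi_{ideal_quot (power_ideal qP n0)} x.
HB.instance Definition _ := GRing.RMorphism.copy proj_power
  (\pi_{ideal_quot (power_ideal qP n0)} : R -> {ideal_quot (power_ideal qP n0)}).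

Local Notation qr := (proj_power (q ^+ r)).

Lemma proj_power_eq0 x : (proj_power x == 0) = (x \in power_ideal qP n0).
Proof.
rewrite -[0](rmorph0 proj_power) /proj_power.
by rewrite -(Quotient.idealrBE (power_ideal qP n0)) subr0.
Qed.

Definition K_pred : {pred autA1 Rn} :=
  [pred g : autA1 Rn | `[< exists h : {poly Rn}, g = 'X + qr *: h :> {poly Rn} >]].

Lemma K_conj (f g : autA1 Rn) : g \in K_pred -> (f * g * f^-1)%g \in K_pred.
Proof.
move=> /asboolP[h gE]; apply/asboolP.
have fV : aut_poly f \Po aut_poly f^-1%g = 'X.
  exact: (congr1 (@aut_poly Rn) (mulgV f)).
have [k kE] := comp_poly_cong f (aut_poly f^-1%g) qr (h \Po aut_poly f^-1%g).
exists k; rewrite -fV -kE /= -comp_polyA gE.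
by rewrite comp_polyD comp_polyX comp_polyZ.
Qed.

Fact K_group_closed : group_closed K_pred.
Proof.
split; first by apply/asboolP; exists 0; rewrite scaler0 addr0.
have KM (f g : autA1 Rn) :
    f \in K_pred -> g \in K_pred -> (f * g)%g \in K_pred.
  move=> /asboolP[h fE] /asboolP[k gE]; apply/asboolP.
  exists (k + (h \Po aut_poly g)).
  rewrite /= fE comp_polyD comp_polyX comp_polyZ {1}gE.
  by rewrite scalerDr addrA.
move=> f g Kf Kg; apply: KM => //.
move: Kg => /asboolP[k gE]; apply/asboolP; exists (- (k \Po aut_poly g^-1%g)).
have : aut_poly g \Po aut_poly g^-1%g = 'X.
  exact: (congr1 (@aut_poly Rn) (mulgV g)).
rewrite {1}gE comp_polyD comp_polyX comp_polyZ => <-.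
by rewrite scalerN addrK.
Qed.

Record K := InK { K_aut :> autA1 Rn; K_autP : K_aut \in K_pred }.
HB.instance Definition _ := [isSub for K_aut].
HB.instance Definition _ := [Choice of K by <:].
HB.instance Definition _ :=
  SubChoice_isSubGroup.Build (autA1 Rn) K_pred K K_group_closed.

Definition Ad (f : autA1 Rn) (g : K) : K :=
  @InK (f * g * f^-1)%g (K_conj f (K_autP g)).

Fact K_cofactor_ex (g : K) :
  exists h : {poly Rn}, (g : {poly Rn}) == 'X + qr *: h.
Proof. by have /asboolP[h gE] := K_autP g; exists h; apply/eqP. Qed.

(* Some h with g = T + q^r h. It is not unique, but the R-multiplication below
   does not depend on it: see [K_scaleE]. *)
Definition K_cofactor (g : K) : {poly Rn} := xchoose (K_cofactor_ex g).

Fact K_scale_subproof1 (nr : (n < 2 * r)%N) (c : R) (g : K) :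
  `[< comp_invertible ('X + (qr * proj_power c) *: K_cofactor g) >].
Proof.
have qrqr : qr * qr = 0.
  rewrite -rmorphM -exprD addnn -mul2n; apply/eqP; rewrite proj_power_eq0.
  by apply/asboolP; exists (q ^+ (2 * r - n)); rewrite -exprD subnKC // ltnW.
pose h := proj_power c *: K_cofactor g.
have inv (b : {poly Rn}) : ('X + qr *: b) \Po ('X - qr *: b) = 'X.
  rewrite comp_polyD comp_polyX comp_polyZ -scalerN.
  have [k ->] := comp_poly_cong b 'X qr (- b).
  by rewrite comp_polyXr scalerDr scalerA qrqr scale0r addr0 scalerN subrK.
rewrite -scalerA -/h; apply/asboolP; exists ('X - qr *: h); split=> //.
by have := inv (- h); rewrite scalerN opprK.
Qed.

Fact K_scale_subproof2 (nr : (n < 2 * r)%N) (c : R) (g : K) :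
  AutA1 (K_scale_subproof1 nr c g) \in K_pred.
Proof.
by apply/asboolP; exists (proj_power c *: K_cofactor g); rewrite scalerA.
Qed.

Definition K_scale nr c (g : K) : K :=
  @InK (@AutA1 Rn ('X + (qr * proj_power c) *: K_cofactor g)
          (K_scale_subproof1 nr c g))
    (K_scale_subproof2 nr c g).

Lemma K_scaleE nr c (g : K) (h : {poly Rn}) :
  g = 'X + qr *: h :> {poly Rn} ->
  K_scale nr c g = 'X + (qr * proj_power c) *: h :> {poly Rn}.
Proof.
move=> gE; have /eqP := xchooseP (K_cofactor_ex g); rewrite -/(K_cofactor g).
move=> gE'; rewrite /= mulrC -!scalerA; congr ('X + _ *: _).
by apply: (addrI 'X); rewrite -gE -gE'.
Qed.

End Kernels.

(* K_{n,r} is the kernel of the coefficientwise reduction modulo q^r. *)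
Lemma K_predE (R : comNzRingType) (q : R) (qP : generates_prime q) (n r : nat)
    (n0 : (0 < n)%N) (r0 : (0 < r)%N) (F : {poly R})
    (g : autA1 (quot_power qP n0)) :
    (r <= n)%N -> map_poly (proj_power qP n0) F = g ->
  (g \in K_pred r) <-> map_poly (proj_power qP r0) F = 'X.
Proof.
move=> rn Fg.
have ideal_le x : x \in power_ideal qP n0 -> x \in power_ideal qP r0.
  move=> /asboolP[y ->]; apply/asboolP; exists (q ^+ (n - r) * y).
  by rewrite mulrA -exprD subnKC.
have subE k (k0 : (0 < k)%N) i : (map_poly (proj_power qP k0) F - 'X)`_i
    = proj_power qP k0 (F - 'X)`_i.
  by rewrite -coef_map rmorphB /= map_polyX.
split=> [/asboolP[h gE]|FX].
  apply/eqP; rewrite -subr_eq0; apply/eqP/polyP => i; rewrite coef0 subE.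
  have [y hy] : exists y, proj_power qP n0 y = h`_i.
    by exists (repr (h`_i : {ideal_quot (power_ideal qP n0)})); apply: reprK.
  have : proj_power qP n0 ((F - 'X)`_i - q ^+ r * y) == 0.
    by rewrite rmorphB rmorphM /= hy -subE Fg gE (addrC 'X) addrK coefZ subrr.
  rewrite proj_power_eq0 => /ideal_le /asboolP[z zE]; apply/eqP.
  rewrite proj_power_eq0; apply/asboolP; exists (z + y).
  by rewrite mulrDr -zE subrK.
apply/asboolP.
have ex_y i : exists z, (F - 'X)`_i = q ^+ r * z.
  have : (F - 'X)`_i \in power_ideal qP r0.
    by rewrite -proj_power_eq0 -subE FX subrr coef0.
  by move=> /asboolP.
have [y yE] := boolp.choice ex_y.
exists (\poly_(i < size (F - 'X)) proj_power qP n0 (y i)).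
apply/eqP; rewrite addrC -subr_eq -Fg; apply/eqP/polyP => i.
rewrite subE coefZ coef_poly; case: ltnP => [_|iF].
  by rewrite yE rmorphM.
by rewrite nth_default // rmorph0 mulr0.
Qed.

(* Main.v *)
Require Import Defs.
From mathcomp Require Import all_boot all_order all_algebra.
From mathcomp Require Import ring boolp.

Set Implicit Arguments.
Unset Strict Implicit.

Import GRing.Theory.
Local Open Scope ring_scope.

(** Since [2r > n], [q^r] squares to zero in [R/q^n], so the Taylor expansion
    of [f] stops at first order: conjugating [T + q^r h] by [f] gives
    [T + q^r (h f') \o f^-1], whose [q^r]-part is linear in [h]. *)

Lemma comp_polyD_sqr0 (B : comNzRingType) (f p h : {poly B}) (a : B) :
  a * a = 0 -> f \Po (p + a *: h) = f \Po p + a *: (h * (f^`() \Po p)).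
Proof.
move=> a2; elim/poly_ind: f => [|f c IH].
  by rewrite deriv0 !comp_poly0 mulr0 scaler0 addr0.
have a2P : a%:P * a%:P = 0 by rewrite -polyCM a2.
rewrite derivD derivM derivX derivC addr0 mulr1.
rewrite !comp_polyD !comp_polyM !comp_polyX !comp_polyC IH -!mul_polyC.
set u := f \Po p; set v := f^`() \Po p.
(* The product [(u + a h v) (p + a h)] is expanded so that its only second-order term carries the
   factor [a * a]. *)
transitivity (u * p + c%:P + a%:P * (h * (v * p + u)) +
              (a%:P * a%:P) * (h * v * h)); first by ring.
by rewrite a2P mul0r addr0.
Qed.

(** The scalar [a] is kept general because the formula serves twice: for [g] with [a] the class of
    [q ^+ r], and for its multiple by [c] with [a] the class of [q ^+ r] times that of [c]. *)
Lemma autA1_conj_sqr0 (B : comNzRingType) (f g : autA1 B) (h : {poly B})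
    (a : B) :
  a * a = 0 -> g = 'X + a *: h :> {poly B} ->
  (f * g * f^-1)%g
    = 'X + a *: ((h * (aut_poly f)^`()) \Po aut_poly f^-1%g) :> {poly B}.
Proof.
move=> a2 gE.
have fV : aut_poly f \Po aut_poly f^-1%g = 'X.
  exact: (congr1 (@aut_poly B) (mulgV f)).
rewrite /= -comp_polyA gE comp_polyD comp_polyX comp_polyZ.
by rewrite comp_polyD_sqr0 // fV comp_polyM.
Qed.

Lemma proj_power_sqr0 (R : comNzRingType) (q : R) (qP : generates_prime q)
    (n r : nat) (n0 : (0 < n)%N) :
  (n <= 2 * r)%N ->
  proj_power qP n0 (q ^+ r) * proj_power qP n0 (q ^+ r) = 0.
Proof.
move=> nr; rewrite -rmorphM -exprD addnn -mul2n.
apply/eqP; rewrite proj_power_eq0.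
by apply/asboolP; exists (q ^+ (2 * r - n)); rewrite -exprD subnKC.
Qed.

Theorem theorem5p2 (R : comNzRingType) (q : R)
    (q_torsion_free : torsion_free q) (q_prime : generates_prime q)
    (n r : nat) (n_gt0 : (0 < n)%N) (n_lt_2r : (n < 2 * r)%N)
    (f : autA1 (quot_power q_prime n_gt0)) (g : K q_prime n_gt0 r) (c : R) :
  Ad f (K_scale n_lt_2r c g) = K_scale n_lt_2r c (Ad f g).
Proof.
have qr2 := proj_power_sqr0 q_prime n_gt0 (ltnW n_lt_2r).
have /asboolP[h gE] := K_autP g.
apply: val_inj; apply: val_inj.
(* Scaling does not depend on the cofactor, so the explicit one from the conjugation formula may
   replace the chosen one. *)
rewrite [RHS](K_scaleE (g := Ad f g) _ _ (autA1_conj_sqr0 f qr2 gE)).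
apply: autA1_conj_sqr0; last exact: K_scaleE.
by rewrite mulrACA qr2 mul0r.
Qed.
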